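(* Let $\mathrm{G}$ be a free amalgamation group acting transitively on a countably infinite set $U$, and let $c:U\to 2$. If for some $i\in 2$ we have $\rho(c^{-1}(i))\neq\rho(U)$, then there is an embedding $f$ for $\mathrm{G}$ with $f[U]\subseteq c^{-1}(1-i)$.
   Context: $\mathrm{G}$ is a subgroup of the symmetric group of $U$. For $S\subseteq U$, $\rho(S)$ is the set of finite $A\subseteq U$ such that $g[A]\subseteq S$ for some $g\in\mathrm{G}$ (so $\rho(U)$ is the set of all finite subsets of $U$). An embedding for $\mathrm{G}$ is an injection $f:U\to U$ such that for every finite $A\subseteq U$ some $g\in\mathrm{G}$ agrees with $f$ on $A$. The closure of $\mathrm{G}$ is $\mathrm{G}$ together with all bijective embeddings for $\mathrm{G}$. $\mathrm{G}$ is a free amalgamation group if its closure is the automorphism group of a homogeneous relational structure with domain $U$ whose age is a free amalgamation age (closed under induced substructures and under free amalgams: the union of two structures agreeing on a common part with no relation holding on a tuple meeting both non-common parts). Homogeneous: every isomorphism between finite induced substructures extends to an automorphism. *)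

(* Defs.v *)
From mathcomp Require Import all_boot.
From mathcomp Require Import mathcomp_extra boolp classical_sets functions cardinality.

Set Implicit Arguments.
Unset Strict Implicit.
Unset Printing Implicit Defensive.

Local Open Scope classical_set_scope.

(** * Relational structures *)

Record language := Language {
  symbol :> Type;
  arity : symbol -> nat }.

(* A structure with domain [V]; an [n]-tuple over [V] is a map ['I_n -> V]. *)
Definition structure (L : language) (V : Type) :=
  forall R : L, set ('I_(arity R) -> V).

Definition automorphisms (L : language) (U : Type) (M : structure L U) :
    set (U -> U) :=
  [set g | bijective g /\
           forall (R : L) (t : 'I_(arity R) -> U), M R (g \o t) <-> M R t].

(* Only the values of [p] on [A] matter: it is an isomorphism from the
   substructure induced on [A] to the one induced on [B]. *)
Definition partial_isomorphism (L : language) (U : Type) (M : structure L U)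
    (A B : set U) (p : U -> U) :=
  set_bij A B p /\
  forall (R : L) (t : 'I_(arity R) -> U),
    (forall j, A (t j)) -> (M R (p \o t) <-> M R t).

Definition homogeneous (L : language) (U : Type) (M : structure L U) :=
  forall (A B : set U) (p : U -> U),
    finite_set A -> finite_set B -> partial_isomorphism M A B p ->
    exists2 g, automorphisms M g & forall x, A x -> g x = p x.

Definition fin_class (L : language) := forall V : finType, structure L V -> Prop.

(* The finite structures isomorphic to an induced substructure of [M]. *)
Definition age (L : language) (U : Type) (M : structure L U) : fin_class L :=
  fun V N => exists2 e : V -> U, injective e &
    forall (R : L) (t : 'I_(arity R) -> V), N R t <-> M R (e \o t).

Definition induced (L : language) (V : finType) (D : {set V})
    (N : structure L V) : structure L {x : V | x \in D} :=
  fun R t => N R (val \o t).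

Arguments induced {L V} D N R _ : rename.

Definition closed_under_substructures (L : language) (K : fin_class L) :=
  forall (V : finType) (N : structure L V) (D : {set V}),
    K V N -> K _ (induced D N).

(* Two structures with domains [D1] and [D2] induce the same structure on
   [D1 :&: D2], which may be empty. *)
Definition agree (L : language) (V : finType) (D1 D2 : {set V})
    (N1 : structure L {x : V | x \in D1})
    (N2 : structure L {x : V | x \in D2}) :=
  forall (R : L) (t1 : 'I_(arity R) -> {x : V | x \in D1})
                 (t2 : 'I_(arity R) -> {x : V | x \in D2}),
    val \o t1 = val \o t2 -> (N1 R t1 <-> N2 R t2).

(* The union of [N1] and [N2]: a tuple in a relation lies inside [D1] or inside
   [D2], so it never meets both [D1 :\: D2] and [D2 :\: D1]. *)
Definition free_amalgam (L : language) (V : finType) (D1 D2 : {set V})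
    (N1 : structure L {x : V | x \in D1})
    (N2 : structure L {x : V | x \in D2}) : structure L V :=
  fun R t => (exists2 t1, N1 R t1 & t = val \o t1) \/
             (exists2 t2, N2 R t2 & t = val \o t2).

Definition closed_under_free_amalgams (L : language) (K : fin_class L) :=
  forall (V : finType) (D1 D2 : {set V})
         (N1 : structure L {x : V | x \in D1})
         (N2 : structure L {x : V | x \in D2}),
    (D1 :|: D2)%SET = [set: V]%SET -> agree N1 N2 ->
    K _ N1 -> K _ N2 -> K V (free_amalgam N1 N2).

Definition free_amalgamation_age (L : language) (K : fin_class L) :=
  closed_under_substructures K /\ closed_under_free_amalgams K.

(** * Permutation groups *)

Definition permutation_group (U : Type) (G : set (U -> U)) :=
  [/\ forall g, G g -> bijective g,
      G id,
      forall g h, G g -> G h -> G (g \o h) &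
      forall g h, G g -> cancel g h -> cancel h g -> G h].

Definition transitive_action (U : Type) (G : set (U -> U)) :=
  forall x y : U, exists2 g, G g & g x = y.

Definition rho (U : Type) (G : set (U -> U)) (S : set U) : set (set U) :=
  [set A | finite_set A /\ exists2 g, G g & g @` A `<=` S].

Definition embedding (U : Type) (G : set (U -> U)) (f : U -> U) :=
  injective f /\
  forall A : set U, finite_set A ->
    exists2 g, G g & forall x, A x -> g x = f x.

Definition group_closure (U : Type) (G : set (U -> U)) : set (U -> U) :=
  G `|` [set f | bijective f /\ embedding G f].

Definition free_amalgamation_group (U : Type) (G : set (U -> U)) :=
  exists (L : language) (M : structure L U),
    [/\ group_closure G = automorphisms M,
        homogeneous M &
        free_amalgamation_age (age M)].

(* Main.v *)
(* Call the colour [i] red, and let [A] be a finite set of least size for which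
   some finite [F0] has no red copy of [A] free over it (the set with no red copy
   given by the hypothesis shows that [A] exists, with [F0] empty); [A] is not
   empty, so write it as [a |` A'].  By minimality there are red copies of [A']
   free over any given finite set.  An embedding of [U] is then built point by
   point: having placed finitely many points outside [F0], take a red copy [E] of
   [A'] free over them and [F0], and use free amalgamation and transitivity to
   place the next point [z] so that [E] and [z] form a copy of [A] free over
   [F0].  As [E] is red, [z] is not. *)

Require Import Defs.
From mathcomp Require Import all_boot.
From mathcomp Require Import mathcomp_extra boolp classical_sets functions cardinality.

Local Open Scope classical_set_scope.

(** * Enumeration of finite sets and induction on them *)

Lemma finite_set_enum (T : Type) (A : set T) : finite_set A ->
  exists n (e : 'I_n -> T), injective e /\ range e = A.
Proof.
elim/Pchoice: T A => T A /finite_seqP[s ->].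
exists (size (undup s)), (tnth (in_tuple (undup s))); split.
  by apply/tuple_uniqP; apply: undup_uniq.
rewrite eqEsubset; split=> [_ [i _ <-]|x /=].
  by rewrite /= -mem_undup; apply: mem_tnth.
by rewrite -mem_undup => /(tnthP (in_tuple (undup s)))[i ->]; exists i.
Qed.

Lemma finite_set_ind (T : Type) (P : set T -> Prop) :
  P set0 ->
  (forall a A, finite_set A -> ~ A a -> P A -> P (a |` A)) ->
  forall A, finite_set A -> P A.
Proof.
elim/Pchoice: T P => T P P0 PS A /finite_seqP[s ->].
elim: s => [|a s IHs]; first by rewrite classical_sets.set_nil.
have -> : [set` a :: s] = a |` [set` s].
  rewrite eqEsubset; split=> x; rewrite /= inE.
    by case/predU1P; [left|right].
  by case=> [->|sx]; apply/predU1P; [left|right].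
have [sa|/negP sa] := boolP (a \in s).
  suff -> : a |` [set` s] = [set` s] by [].
  by rewrite eqEsubset; split=> x; [case=> [->|]|right].
exact: PS.
Qed.

(** * Homogeneity and free amalgamation inside a structure *)

Section Automorphisms.
Context {L : language} {U : Type} (M : structure L U).

Lemma automorphism_id : automorphisms M id.
Proof. by split=> //; exists id. Qed.

Lemma automorphism_comp g h :
  automorphisms M g -> automorphisms M h -> automorphisms M (g \o h).
Proof.
move=> [gb gM] [hb hM]; split=> [|R t]; first exact: bij_comp.
exact: iff_trans (gM R (h \o t)) (hM R t).
Qed.

Lemma automorphism_inv g : automorphisms M g ->
  exists2 h, automorphisms M h & cancel g h /\ cancel h g.
Proof.
move=> [[h gK hK] gM]; exists h => //; split=> [|R t]; first by exists g.
rewrite -(gM R (h \o t)) (_ : g \o _ = t)// funeqE => j /=.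
by rewrite hK.
Qed.

Lemma automorphism_inj g : automorphisms M g -> injective g.
Proof. by case=> /bij_inj. Qed.

(** The union of [S] and [T] induces the free amalgam of its two parts; they may overlap, and
    [free_over] adds disjointness. *)
Definition independent (S T : set U) :=
  forall (R : L) (t : 'I_(arity R) -> U), M R t ->
    (forall j, S (t j) \/ T (t j)) ->
    (forall j, S (t j)) \/ (forall j, T (t j)).

Definition free_over (S T : set U) := S `&` T = set0 /\ independent S T.

(** Homogeneity for two indexed copies of one finite structure, so that its uses need not name a
    partial map. *)
Lemma homogeneous_extend (I : Type) (e1 e2 : I -> U) :
  homogeneous M -> finite_set [set: I] -> injective e1 -> injective e2 ->
  (forall (R : L) (t : 'I_(arity R) -> I), M R (e1 \o t) <-> M R (e2 \o t)) ->
  exists2 g, automorphisms M g & forall i, g (e1 i) = e2 i.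
Proof.
move=> Mhom Ifin e1_inj e2_inj e12.
have [p pE] : {p : U -> U & forall i, p (e1 i) = e2 i}.
  apply: (@cid _ (fun p : U -> U => forall i, p (e1 i) = e2 i)).
  have /choice[p pP] : forall x, exists y, forall i, e1 i = x -> y = e2 i.
    move=> x; have [[i <-]|nx] := pselect (exists i, e1 i = x).
      by exists (e2 i) => k /e1_inj ->.
    by exists x => i ix; case: nx; exists i.
  by exists p => i; apply: pP.
have [g gM gp] : exists2 g, automorphisms M g & forall x, range e1 x -> g x = p x.
  apply: (Mhom (range e1) (range e2)); [exact: finite_image..|split].
    split=> [_ [i _ <-]|_ _ /set_mem[i _ <-] /set_mem[k _ <-]|_ [i _ <-]].
    - by rewrite /= pE; exists i.
    - by rewrite !pE => /e2_inj ->.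
    - by exists (e1 i); [exists i|rewrite pE].
  move=> R t tr.
  have /choice[s sE] : forall j, exists i, e1 i = t j.
    by move=> j; have [i _ <-] := tr j; exists i.
  have -> : t = e1 \o s by rewrite funeqE => j /=; rewrite sE.
  by rewrite e12 (_ : p \o _ = e2 \o s)// funeqE => j /=; rewrite pE.
by exists g => // i; rewrite gp ?pE//; exists i.
Qed.

(* [T] can be moved over [C] so that it meets [S] only in [C] and no relation
   holds across.  The amalgam lives on the disjoint sum of [S] and [T `\` C],
   so that [D1] is a copy of [S] and [D2] one of [T]. *)
Lemma free_extension (C S T : set U) :
  homogeneous M -> closed_under_free_amalgams (age M) ->
  finite_set S -> finite_set T -> C `<=` S -> C `<=` T ->
  exists2 g, automorphisms M g &
    [/\ forall x, C x -> g x = x,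
        forall x, T x -> S (g x) -> C x &
        independent S (g @` T)].
Proof.
move=> Mhom Mfree Sfin Tfin CS CT.
have [n [s [s_inj sE]]] := finite_set_enum _ _ Sfin.
have [m [u [u_inj uE]]] := finite_set_enum _ _ (finite_setD C Tfin).
pose V : finType := ('I_n + 'I_m)%type.
(* [q] need not be injective, since [S] and [T] may meet outside [C]; it is injective on [D1] and on
   [D2], which suffices. *)
pose q (v : V) := match v with inl i => s i | inr j => u j end.
pose isl (v : V) := if v is inl _ then true else false.
pose D1 := [set v : V | isl v]%SET.
pose D2 := [set v : V | ~~ isl v || `[< C (q v) >]]%SET.
have [uT uC] : (forall j, T (u j)) /\ (forall j, ~ C (u j)).
  by split=> j; have [] : (T `\` C) (u j) by rewrite -uE; exists j.
have sS i : S (s i) by rewrite -sE; exists i.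
have D2inj v w : v \in D2 -> w \in D2 -> q v = q w -> v = w.
  rewrite !inE; case: v w => [i|i] [j|j] //=.
  - by move=> _ _ /s_inj ->.
  - by move=> /asboolP Ci _ ij; case: (uC j); rewrite -ij.
  - by move=> _ /asboolP Ci ij; case: (uC i); rewrite ij.
  - by move=> _ _ /u_inj ->.
have D1inj v w : v \in D1 -> w \in D1 -> q v = q w -> v = w.
  by rewrite !inE; case: v w => [i|i] [j|j] //= _ _ /s_inj ->.
pose N1 : structure L {x : V | x \in D1} := fun R t => M R (q \o (val \o t)).
pose N2 : structure L {x : V | x \in D2} := fun R t => M R (q \o (val \o t)).
have [e e_inj eM] : age M (free_amalgam N1 N2).
  apply: Mfree.
  - by apply/setP => v; rewrite !inE; case: v.
  - by move=> R t1 t2 t12; rewrite /N1 /N2 t12.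
  - exists (q \o val) => // v w /D1inj h.
    by apply: val_inj; apply: h; apply: valP.
  - exists (q \o val) => // v w /D2inj h.
    by apply: val_inj; apply: h; apply: valP.
have ordfin k : finite_set [set: 'I_k] by apply: finite_finset.
have eM1 R (t : 'I_(arity R) -> V) : (forall j, t j \in D1) ->
    M R (e \o t) <-> M R (q \o t).
  move=> tD.
  rewrite -eM; split=> [[[t1 N1t ->]|[t2 N2t ->]]//|tM].
  by left; exists (fun j => exist (fun v : V => v \in D1) (t j) (tD j)).
have eM2 R (t : 'I_(arity R) -> V) : (forall j, t j \in D2) ->
    M R (e \o t) <-> M R (q \o t).
  move=> tD.
  rewrite -eM; split=> [[[t1 N1t ->]|[t2 N2t ->]]//|tM].
  by right; exists (fun j => exist (fun v : V => v \in D2) (t j) (tD j)).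
(* The copy [e] of the amalgam lies anywhere in [U]; [a] brings its left summand back onto [S], and
   [g] will send [T] onto the image of [D2]. *)
have [a aM ae] : exists2 a, automorphisms M a & forall i, a (e (inl i)) = s i.
  apply: (homogeneous_extend _ (e \o inl) s) => //.
    by move=> i j /e_inj[].
  move=> R t; apply: (eM1 R (inl \o t)) => j; by rewrite inE.
have qD v : v \in D2 -> T (q v).
  rewrite inE; by case: v => [i /asboolP|j _] //=; apply: CT.
have [g gM gq] : exists2 g, automorphisms M g &
    forall v : {v : V | v \in D2}, g (q (val v)) = a (e (val v)).
  apply: (homogeneous_extend _ (q \o val) (a \o (e \o val))) => //.
  - exact: finite_finset.
  - move=> v w /D2inj h; apply: val_inj; apply: h; exact: valP.
  - by move=> v w /(automorphism_inj _ aM)/e_inj/val_inj.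
  - move=> R t; have [_ aM'] := aM; rewrite (aM' R (e \o (val \o t))) eM2//.
    by move=> j; apply: valP.
have {}gq v : v \in D2 -> g (q v) = a (e v).
  by move=> vD; apply: (gq (exist _ v vD)).
have CD x : C x -> exists2 i, x = s i & (inl i : V) \in D2.
  move=> Cx; have : S x by apply: CS.
  by rewrite -{1}sE => -[i _ ix]; exists i; rewrite // inE /= ix; apply/asboolP.
have Tq x : T x -> exists2 v, v \in D2 & x = q v.
  move=> Tx; have [/CD[i -> iD]|nCx] := pselect (C x); first by exists (inl i).
  have : range u x by rewrite uE.
  by case=> j _ <-; exists (inr j); rewrite // inE.
exists g => //; split.
- by move=> x /CD[i -> iD]; rewrite (gq _ iD) ae.
- move=> x /Tq[v vD ->]; rewrite gq// -sE => -[i _].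
  rewrite -ae => /(automorphism_inj _ aM)/e_inj iv.
  by move: vD; rewrite -iv inE /= => /asboolP.
move=> R t Mt tST.
have /choice[v vE] : forall j, exists w, t j = a (e w).
  move=> j; case: (tST j) => [|[x /Tq[w wD ->] <-]].
    by rewrite -sE => -[i _ <-]; exists (inl i); rewrite ae.
  by exists w; rewrite gq.
have [_ aM'] := aM.
have : M R (e \o v).
  by rewrite -aM' (_ : _ \o _ = t)// funeqE => j /=; rewrite vE.
rewrite -eM => -[[t1 _ vt]|[t2 _ vt]]; [left|right] => j.
- rewrite vE vt /=; case: (t1 j) => w /=; rewrite inE.
  by case: w => // i _; rewrite ae.
- rewrite vE vt /= -gq; last exact: valP.
  by exists (q (val (t2 j))) => //; apply: qD; apply: valP.
Qed.

(** As no relation holds across either pair, the identity on [D] and [m] on [E] together form a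
    partial isomorphism. *)
Lemma free_over_glue (D E : set U) (m : U -> U) :
  homogeneous M -> finite_set D -> finite_set E -> automorphisms M m ->
  free_over D E -> free_over D (m @` E) ->
  exists2 g, automorphisms M g &
    (forall x, D x -> g x = x) /\ (forall x, E x -> g x = m x).
Proof.
move=> Mhom Dfin Efin mM [DE0 DE] [DmE0 DmE].
have [_ mM'] := mM.
have DEF x : D x -> E x -> False by move=> Dx Ex; rewrite -[False]/(set0 x) -DE0.
have DmEF x : E x -> ~ D (m x).
  by move=> Ex Dx; rewrite -[False]/(set0 (m x)) -DmE0; split=> //; exists x.
pose p x := if `[< D x >] then x else m x.
have pD x : D x -> p x = x by rewrite /p; case: asboolP.
have pE x : E x -> p x = m x.
  by rewrite /p; case: asboolP => // Dx /(DEF _ Dx).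
have [g gM gp] : exists2 g, automorphisms M g &
    forall x, (D `|` E) x -> g x = p x.
  apply: (Mhom (D `|` E) (D `|` m @` E)).
  - by rewrite finite_setU.
  - by rewrite finite_setU; split=> //; apply: finite_image.
  split.
    split=> [x [Dx|Ex]|x y /set_mem[Dx|Ex] /set_mem[Dy|Ey]|x [Dx|[y Ey <-]]].
    - by rewrite /= pD//; left.
    - by rewrite /= pE//; right; exists x.
    - by rewrite !pD.
    - by rewrite (pD x)// (pE y)// => xy; case: (DmEF _ Ey); rewrite -xy.
    - by rewrite (pE x)// (pD y)// => xy; case: (DmEF _ Ex); rewrite xy.
    - by rewrite !pE// => /(automorphism_inj _ mM).
    - by exists x; [left|rewrite pD].
    - by exists y; [right|rewrite pE].
  move=> R t tDE.
  have ptD : (forall j, D (t j)) -> p \o t = t.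
    by move=> tD; rewrite funeqE => j /=; rewrite pD.
  have ptE : (forall j, E (t j)) -> p \o t = m \o t.
    by move=> tE; rewrite funeqE => j /=; rewrite pE.
  split=> tM.
    have : (forall j, D ((p \o t) j)) \/ (forall j, (m @` E) ((p \o t) j)).
      apply: DmE => // j /=; case: (tDE j) => [Dj|Ej].
        by rewrite pD//; left.
      by rewrite pE//; right; exists (t j).
    case=> tp.
      rewrite -ptD// => j; have := tp j; case: (tDE j) => //= Ej.
      by rewrite pE// => /DmEF; case.
    move: tM; rewrite ptE ?mM'// => j.
    case: (tDE j) => // Dj; have [x Ex] := tp j.
    by rewrite /= pD// => xj; case: (DmEF _ Ex); rewrite xj.
  case: (DE R t tM tDE) => tX; first by rewrite ptD.
  by rewrite ptE// mM'.
exists g => //; split=> x xX.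
  by rewrite gp ?pD//; left.
by rewrite gp ?pE//; right.
Qed.

End Automorphisms.

(** * Embeddings built by one-point extensions *)

Section Embeddings.
Context {U : Type}.

(** An embedding need not be onto, so extending the domain point by point suffices; the value at a
    point is stable once it is placed. *)
Lemma embedding_in (H : set (U -> U)) (P : set U) :
  countable [set: U] -> [set: U] !=set0 -> H id ->
  (forall g, H g -> injective g) ->
  (forall g (F : set U) y, H g -> finite_set F ->
     (forall x, F x -> P (g x)) -> ~ F y ->
     exists2 h, H h & (forall x, F x -> h x = g x) /\ P (h y)) ->
  exists2 f, embedding H f & range f `<=` P.
Proof.
move=> /countable_injP[N N_inj] [x0 _] Hid H_inj step.
have {}N_inj x y : N x = N y -> x = y by apply: N_inj; rewrite inE.
have /choice[e eN] : forall n, exists x, forall y, N y = n -> y = x.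
  move=> n; have [[y <-]|nN] := pselect (exists y, N y = n).
    by exists y => z /N_inj.
  by exists x0 => y yn; case: nN; exists y.
have {}eN x : e (N x) = x by rewrite -(eN (N x) x).
pose F n := e @` `I_n.
have Ffin n : finite_set (F n) by apply: finite_image; apply: finite_II.
pose good n g := H g /\ forall x, F n x -> P (g x).
have FS n x : F n.+1 x -> F n x \/ x = e n.
  move=> [k /=]; rewrite ltnS leq_eqVlt => /predU1P[->|kn] <-; first by right.
  by left; exists k.
(* The hypothesis [good n g] sits under the existential so that choice gives a total step
   function. *)
have next n g : exists h, good n g ->
    good n.+1 h /\ forall x, F n x -> h x = g x.
  have [[Hg gP]|ng] := pselect (good n g); last by exists g.
  (* Numbers that are not values of [N] all name [x0], so [e n] may already be placed. *)
  have [Fen|nFen] := pselect (F n (e n)).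
    exists g => _; split=> //; split=> // x /FS[|->]; exact: gP.
  have [h Hh [hg hP]] := step g (F n) (e n) Hg (Ffin n) gP nFen.
  exists h => _; split=> //; split=> // x /FS[Fx|->//].
  by rewrite hg//; apply: gP.
have /choice[nx nxP] : forall ng : nat * (U -> U), exists h, good ng.1 ng.2 ->
    good ng.1.+1 h /\ forall x, F ng.1 x -> h x = ng.2 x.
  by move=> [n g]; apply: next.
pose G := fix G n := if n is n'.+1 then nx (n', G n') else id.
have Ggood n : good n (G n).
  elim: n => [|n IHn]; first by split=> // x [k].
  by have [] := nxP (n, G n) IHn.
have Gext m n x : F m x -> (m <= n)%N -> G n x = G m x.
  move=> Fx; elim: n => [|n IHn]; first by rewrite leqn0 => /eqP <-.
  rewrite leq_eqVlt => /predU1P[<-//|]; rewrite ltnS => mn.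
  have [_ /= -> ] := nxP (n, G n) (Ggood n); first exact: IHn.
  by case: Fx => k km <-; exists k => //; apply: leq_trans mn.
have Fx x : F (N x).+1 x by exists (N x); rewrite /= ?eN.
pose f x := G (N x).+1 x.
have fG n x : (N x < n)%N -> G n x = f x by move=> ?; apply: Gext.
have fH A : finite_set A -> exists2 g, H g & forall x, A x -> g x = f x.
  move=> Afin; suff [n nA] : exists n, forall x, A x -> (N x < n)%N.
    exists (G n); first by have [] := Ggood n.
    by move=> x Ax; apply: fG; apply: nA.
  elim/finite_set_ind: A / Afin => [|a A _ _ [n nA]]; first by exists 0%N.
  exists (maxn (N a).+1 n) => x [->|/nA xn]; first exact: leq_maxl.
  by apply: leq_trans xn _; apply: leq_maxr.
exists f.
  split=> // x y xy.
  have [g Hg gf] := fH [set x; y] (finite_set2 x y).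
  by apply: (H_inj g Hg); rewrite !gf//; [right|left].
by move=> _ [x _ <-]; have [_ ] := Ggood (N x).+1; apply.
Qed.

Lemma group_closure_approx (G : set (U -> U)) g (A : set U) :
  group_closure G g -> finite_set A ->
  exists2 h, G h & forall x, A x -> h x = g x.
Proof. by case=> [Gg _|[_ [_ gG]] /gG//]; exists g. Qed.

End Embeddings.

(** * Placing points off the red set *)

Section AvoidingRed.
Context {L : language} {U : Type} (M : structure L U).
Context (Mhom : homogeneous M) (Mfree : closed_under_free_amalgams (age M)).
Context (Mtrans : transitive_action (automorphisms M)) (red : set U).

(* The image of [y] is chosen as a point [z] completing a red copy [E] of [A]
   to a copy of [a |` A] that is free over [F0]; such a [z] cannot be red.  To
   get it, first move [g y] freely away from [F0], then glue on a copy of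
   [a |` A] freely at that point, and finally use homogeneity over
   [F0 `|` g @` F] to move its [A]-part onto [E]. *)
Lemma non_red_extension (F0 A : set U) a :
  finite_set F0 -> finite_set A -> ~ A a ->
  (forall k, automorphisms M k -> k @` (a |` A) `<=` red ->
     ~ free_over M F0 (k @` (a |` A))) ->
  (forall F, finite_set F -> exists2 k, automorphisms M k &
     k @` A `<=` red /\ free_over M F (k @` A)) ->
  forall g (F : set U) y, automorphisms M g -> finite_set F ->
    (forall x, F x -> ~ F0 (g x) /\ ~ red (g x)) -> ~ F y ->
    exists2 h, automorphisms M h &
      (forall x, F x -> h x = g x) /\ (~ F0 (h y) /\ ~ red (h y)).
Proof.
move=> F0fin Afin Aa noA redA g F y gM Ffin gF Fy.
pose X := g @` F; pose D := F0 `|` X.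
have Xfin : finite_set X by apply: finite_image.
have Dfin : finite_set D by rewrite finite_setU.
have XF0 x : X x -> ~ F0 x by case=> w /gF[nF0 _] <-.
(* With [z] the new place of [g y], a relation on [D] and [z] lies inside [D] or inside [X] and [z];
   none ties [z] to [F0]. *)
have [g1 g1M [g1X g1D g1ind]] :
    exists2 g1, automorphisms M g1 & [/\ forall x, X x -> g1 x = x,
      forall x, (X `|` [set g y]) x -> D (g1 x) -> X x &
      independent M D (g1 @` (X `|` [set g y]))].
  apply: free_extension => //.
  - by rewrite finite_setU; split=> //; apply: finite_set1.
  - by move=> x; right.
pose z := g1 (g y).
have Dz : ~ D z.
  move=> /(g1D (g y)) []; first by right.
  by move=> w Fw /(automorphism_inj _ _ gM) wy; apply: Fy; rewrite -wy.
have g1T x : (g1 @` (X `|` [set g y])) x -> X x \/ x = z.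
  by case=> w [Xw|->] <-; [left; rewrite g1X|right].
have [k1 k1M k1a] := Mtrans a z.
pose S := D `|` [set z].
have [g2 g2M [g2z g2S g2ind]] :
    exists2 g2, automorphisms M g2 & [/\ forall x, [set z] x -> g2 x = x,
      forall x, (k1 @` (a |` A)) x -> S (g2 x) -> [set z] x &
      independent M S (g2 @` (k1 @` (a |` A)))].
  apply: free_extension => //.
  - by rewrite finite_setU; split=> //; apply: finite_set1.
  - by apply: finite_image; rewrite finite_setU; split=> //; apply: finite_set1.
  - by move=> x; right.
  - by move=> x ->; exists a => //; left.
have {}g2z : g2 z = z by apply: g2z.
pose k2 := g2 \o k1.
have k2M : automorphisms M k2 by apply: automorphism_comp.
have k2a : k2 a = z by rewrite /k2 /= k1a.
pose E := k2 @` A.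
have Efin : finite_set E by apply: finite_image.
have Ez : ~ E z.
  by case=> w Aw; rewrite -k2a => /(automorphism_inj _ _ k2M) wa; apply: Aa; rewrite -wa.
have ES x : E x -> ~ S x.
  move=> Ex Sx; case: (Ex) => w Aw wx; apply: Ez.
  suff k1w : k1 w = z by exists w => //; rewrite /k2 /= k1w.
  by apply: g2S; [exists w => //; right|rewrite -[g2 _]/(k2 w) wx].
have {}g2ind : independent M S (E `|` [set z]).
  suff -> : E `|` [set z] = g2 @` (k1 @` (a |` A)) by [].
  by rewrite image_comp -/k2 image_setU image_set1 k2a setUC.
(* A tuple in [D] and [E] avoids [z], so independence over [z] becomes freeness of [E] over [D]. *)
have DE : free_over M D E.
  split.
    by rewrite -subset0 => x [Dx /ES]; apply; left.
  move=> R t Mt tDE.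
  have tz j : t j <> z.
    by move=> tjz; case: (tDE j); rewrite tjz.
  have [j|tS|tT] := g2ind R t Mt.
  - by case: (tDE j); [do 2 left|right; left].
  - by left=> j; case: (tS j) => // /tz.
  - by right=> j; case: (tT j) => // /tz.
have [k kM [kred Dk]] := redA D Dfin.
have [k2' k2'M [k2K k2'K]] := automorphism_inv _ _ k2M.
pose m := k \o k2'.
have mM : automorphisms M m by apply: automorphism_comp.
have mE : m @` E = k @` A.
  by rewrite /E image_comp (_ : m \o k2 = k)// funeqE => x; rewrite /m /= k2K.
have [h hM [hD hE]] : exists2 h, automorphisms M h &
    (forall x, D x -> h x = x) /\ (forall x, E x -> h x = m x).
  by apply: free_over_glue; rewrite ?mE.
have hA : (h \o k2) @` (a |` A) = h z |` k @` A.
  rewrite image_setU image_set1 /= k2a; congr (_ `|` _).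
  by rewrite -mE -image_comp; apply: eq_imagel => x Ex; apply: hE.
have hF0 x : F0 x -> h x = x by move=> F0x; apply: hD; left.
(* [h] fixes [F0], so a relation pulls back to a tuple [s] in [F0], [E] and [z]. By [g2ind] it lies
   in [E] and [z], or in [D] and [z], where [g1ind] separates [z] from [F0]. *)
have hfree : free_over M F0 ((h \o k2) @` (a |` A)).
  have h_inj := automorphism_inj _ _ hM.
  have hkA x : ((h \o k2) @` (a |` A)) x <-> exists2 w, (E `|` [set z]) w & h w = x.
    split=> [[w [->|Aw] <-]|[w [[v Av <-]|->] <-]].
    - by exists z; [right|rewrite /= k2a].
    - by exists (k2 w); [left; exists w|].
    - by exists v; [right|].
    - by exists a; [left|rewrite /= k2a].
  have F0E x : F0 x -> ~ (E `|` [set z]) x.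
    move=> F0x [/ES|xz]; first by apply; do 2 left.
    by apply: Dz; rewrite -xz; left.
  split.
    rewrite -subset0 => x [F0x /hkA[w Ew wx]].
    by apply: (F0E x F0x); rewrite -(h_inj _ _ (etrans wx (esym (hF0 _ F0x)))).
  move=> R t Mt tF0.
  have /choice[s sE] : forall j, exists w, h w = t j /\ (F0 w \/ (E `|` [set z]) w).
    move=> j; case: (tF0 j) => [F0j|/hkA[w Ew <-]]; last by exists w; split=> //; right.
    by exists (t j); split; [exact: hF0|left].
  have Ms : M R s.
    have [_ hM'] := hM; rewrite -hM' (_ : h \o s = t)// funeqE => j.
    by have [] := sE j.
  suff [sF0|sEz] : (forall j, F0 (s j)) \/ (forall j, (E `|` [set z]) (s j)).
  - by left=> j; have [<- _] := sE j; rewrite hF0.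
  - by right=> j; apply/hkA; exists (s j) => //; have [] := sE j.
  have [j|sS|] := g2ind R s Ms; last by right.
    by case: (sE j) => _ []; [left; left; left|right].
  have [j|sD|sX] := g1ind R s Ms.
  - case: (sS j) => [|->]; first by left.
    by right; exists (g y) => //; right.
  - left=> j; case: (sE j) => _ [//|[/ES[]|sz]]; first by left.
    by case: Dz; rewrite -sz.
  - right=> j; case: (sE j) => _ [|//] F0j.
    case: (g1T _ (sX j)) => [/XF0//|sz].
    by case: Dz; left; rewrite -sz.
have hMk2 : automorphisms M (h \o k2) by apply: automorphism_comp.
exists (h \o (g1 \o g)); first by do 2 apply: automorphism_comp => //.
split=> [x Fx|].
  have Xx : X (g x) by exists x.
  by rewrite /= g1X// hD//; right.
have -> : (h \o (g1 \o g)) y = h z by [].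
split=> [F0hz|hz_red].
  apply: Dz; left; suff <- : h z = z by [].
  by apply: (automorphism_inj _ _ hM); rewrite hF0.
apply: (noA _ hMk2) => //; rewrite hA => x [->//|]; exact: kred.
Qed.

(** Induction on [A] replaces the choice of a least set: if the smaller set has red copies free over
    every finite set, [non_red_extension] places the points; otherwise a finite [F] without such a
    copy takes the role of [F0]. The empty set is red and free over anything, which settles the base
    case. *)
Lemma avoid_red (F0 A : set U) :
  countable [set: U] -> [set: U] !=set0 -> finite_set F0 -> finite_set A ->
  (forall k, automorphisms M k -> k @` A `<=` red -> ~ free_over M F0 (k @` A)) ->
  exists2 f, embedding (automorphisms M) f & range f `<=` ~` red.
Proof.
move=> Ucount U0 F0fin Afin.
elim/finite_set_ind: A / Afin F0 F0fin => [|a A Afin Aa IHA] F0 F0fin noA.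
  case: (noA id (automorphism_id M)); rewrite image_set0 //; split.
    by rewrite setI0.
  by move=> R t _ tF0; left=> j; case: (tF0 j).
have [redA|] := pselect (forall F, finite_set F -> exists2 k, automorphisms M k &
     k @` A `<=` red /\ free_over M F (k @` A)).
  (* The invariant also keeps the image off [F0], as the next extension step requires. *)
  have [] := @embedding_in U (automorphisms M) [set x | ~ F0 x /\ ~ red x] Ucount U0.
  - exact: automorphism_id.
  - by move=> g; apply: automorphism_inj.
  - exact: (non_red_extension F0 A a).
  - by move=> f fM fred; exists f => // x /fred[].
move=> /existsNP[F /not_implyP[Ffin nF]].
apply: (IHA F Ffin) => k kM kred kfree; apply: nF; by exists k.
Qed.

End AvoidingRed.

(** * Passage between [G] and the automorphism group *)

Theorem theorem8p2 (U : Type) (G : set (U -> U)) (c : U -> bool) (i : bool)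
    (U_countable : countable [set: U]) (U_infinite : infinite_set [set: U])
    (G_group : permutation_group G)
    (G_free : free_amalgamation_group G)
    (G_trans : transitive_action G) :
  rho G (c @^-1` [set i]) <> rho G [set: U] ->
  exists2 f : U -> U, embedding G f & range f `<=` c @^-1` [set ~~ i].
Proof.
move=> rhoN; have [L [M [GM Mhom [_ Mfree]]]] := G_free.
have Mtrans : transitive_action (automorphisms M).
  by move=> x y; have [g Gg gxy] := G_trans x y; exists g => //; rewrite -GM; left.
have [A Afin noA] : exists2 A : set U, finite_set A &
    ~ exists2 g, G g & g @` A `<=` c @^-1` [set i].
  apply: contrapT => allA; apply: rhoN; rewrite eqEsubset; split=> A [Afin].
    by move=> [g Gg _]; split=> //; exists g.
  by move=> _; split=> //; apply: contrapT => nA; apply: allA; exists A.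
have [|||f [f_inj fM] fred] := avoid_red M Mhom Mfree Mtrans (c @^-1` [set i])
    set0 A U_countable _ _ Afin.
- exact: infinite_setN0.
- exact: finite_set0.
(* An automorphism agrees on [A] with an element of [G], so a red copy of [A] under it would be one
   under [G]. *)
- move=> k; rewrite -GM => kG kA _; apply: noA.
  have [g Gg gk] := group_closure_approx _ _ _ kG Afin.
  exists g => // _ [x Ax <-]; rewrite gk//; apply: kA; by exists x.
exists f.
  split=> // B Bfin; have [g gM gf] := fM B Bfin.
  move: gM; rewrite -GM => /group_closure_approx/(_ Bfin)[h Gh hg].
  by exists h => // x Bx; rewrite hg// gf.
by move=> x /fred /= /eqP; case: (c x); case: (i).
Qed.
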